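(* There exist a loop-free matroid $\mathcal M$ and a tropical toric vector bundle $(\mathcal M,\Phi)$ over $\mathbb P^1$ which cannot be extended to a split bundle; that is, for every matroid extension $\phi:\mathcal M\to\mathcal M'$ the tropical toric vector bundle $(\mathcal M',\phi_*\circ\Phi)$ is not split.
   Context: For a loop-free matroid $\mathcal M$, $\operatorname{Berg}(\mathcal M)\subset\mathbb R^{\mathcal M}$ is the set of $w$ such that for every circuit $C$ the minimum $\min_{i\in C}w_i$ is attained at least twice (equivalently, all sets $F^w_t=\{i:w_i\ge t\}$ are flats). For a basis $B$, the apartment $A_B$ is the set of $w\in\operatorname{Berg}(\mathcal M)$ with $w_e=\min\{w_b:b\in C_e\setminus\{e\}\}$ for all $e\notin B$, where $C_e$ is the unique circuit in $B\cup\{e\}$; projection to the $B$-coordinates identifies $A_B$ with $\mathbb R^B$. The fan of $\mathbb P^1$ is the fan in $\mathbb R$ (lattice $\mathbb Z$) with cones $\mathbb R_{\ge0}$, $\mathbb R_{\le0}$, $\{0\}$. A tropical toric vector bundle $(\mathcal M,\Phi)$ over $\mathbb P^1$ is a map $\Phi:\mathbb R\to\operatorname{Berg}(\mathcal M)$ with $\Phi(\mathbb Z)\subset\mathbb Z^{\mathcal M}$ such that each of $\mathbb R_{\ge0},\mathbb R_{\le0}$ is mapped into some apartment $A_B$, linearly in the coordinates $\mathbb R^B$. A matroid extension $\phi:\mathcal M_1\to\mathcal M_2$ is an injection of ground sets of matroids of equal rank such that the matroid induced by $\mathcal M_2$ on $\phi(\mathcal M_1)$ is $\mathcal M_1$.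 It induces $\phi_*:\operatorname{Berg}(\mathcal M_1)\to\operatorname{Berg}(\mathcal M_2)$, $(\phi_*w)_e=\sup\{t:e\in\operatorname{span}\phi(F^w_t)\}$ (span = matroid closure). A pair $(\mathcal M,\Phi)$ is split if the image of $\Phi$ lies in a single apartment of $\operatorname{Berg}(\mathcal M)$. *)

(* Defs.v *)
From HB Require Import structures.
From mathcomp Require Import all_boot all_order all_algebra.
From mathcomp Require Import all_classical all_reals.

Set Implicit Arguments.
Unset Strict Implicit.
Unset Printing Implicit Defensive.

Import Order.TTheory GRing.Theory Num.Theory.

Local Open Scope ring_scope.

Record matroid (E : finType) := Matroid {
  indep : pred {set E};
  indep0 : indep finset.set0;
  indepS : forall I J : {set E}, I \subset J -> indep J -> indep I;
  indep_exchange : forall I J : {set E}, indep I -> indep J ->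
    (#|I| < #|J|)%N -> exists2 e, e \in J :\: I & indep (e |: I)
}.

Section Matroid.
Variables (E : finType) (M : matroid E).
Implicit Types (A B C : {set E}) (e : E).

Definition basis B : bool := maxset (indep M) B.

Definition circuit C : bool := minset (fun A => ~~ indep M A) C.

Definition loop_free : Prop := forall e, indep M [set e].

Definition rank_of A : nat :=
  \max_(I : {set E} | indep M I && (I \subset A)) #|I|.

Definition mrank : nat := rank_of [set: E].

Definition mspan A : {set E} := [set e | rank_of (e |: A) == rank_of A].

End Matroid.

Definition matroid_extension (E1 E2 : finType) (M1 : matroid E1)
    (M2 : matroid E2) (phi : E1 -> E2) : Prop :=
  [/\ injective phi,
      mrank M1 = mrank M2 &
      forall A : {set E1}, indep M2 (phi @: A) = indep M1 A].

Section Berg.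
Variables (R : realType) (E : finType) (M : matroid E).
Implicit Types (A B C : {set E}) (w : {ffun E -> R}).

Definition argmins w A : {set E} := [set i in A | [forall j in A, w i <= w j]].

Definition berg w : Prop :=
  forall C, circuit M C -> (2 <= #|argmins w C|)%N.

Definition is_min_on w A (m : R) : Prop :=
  (exists2 b, b \in A & m = w b) /\ (forall b, b \in A -> m <= w b).

(* When B is a basis and e \notin B there is exactly one circuit C contained
   in e |: B, and C :\ e is nonempty when M is loop-free. *)
Definition apartment B w : Prop :=
  berg w /\
  forall e C, e \notin B -> circuit M C -> C \subset e |: B ->
    is_min_on w (C :\ e) (w e).

Definition level_set w (t : R) : {set E} := [set i | t <= w i].

(* Linearity is required of the coordinates in B only: these identify the
   apartment of B with R^B. *)
Definition linear_into_apartment (Phi : R -> {ffun E -> R})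
    (sigma : interval R) : Prop :=
  exists B, [/\ basis M B,
    forall x, x \in sigma -> apartment B (Phi x) &
    exists L : {linear R^o -> {ffun E -> R^o}},
      forall x, x \in sigma -> forall b, b \in B -> Phi x b = L x b].

Definition toric_bundle_P1 (Phi : R -> {ffun E -> R}) : Prop :=
  [/\ forall x, berg (Phi x),
      forall (n : int) (e : E), Phi n%:~R e \is a Num.int,
      linear_into_apartment Phi `[0, +oo[ &
      linear_into_apartment Phi `]-oo, 0]].

Definition split_bundle (Phi : R -> {ffun E -> R}) : Prop :=
  exists2 B, basis M B & forall x, apartment B (Phi x).

End Berg.

(* If M2 is loop-free and phi is a matroid extension, the set below is nonempty
   (it contains every t <= min w) and bounded above (by max w), so that sup is
   a genuine supremum. With a loop in M2 it would be unbounded. *)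
Definition berg_push (R : realType) (E1 E2 : finType) (M2 : matroid E2)
    (phi : E1 -> E2) (w : {ffun E1 -> R}) : {ffun E2 -> R} :=
  [ffun e => sup [set t : R | e \in mspan M2 (phi @: level_set w t)]%classic].

(* Main.v *)
Require Import Defs.
From mathcomp Require Import all_boot all_order all_algebra.
From mathcomp Require Import all_classical all_reals.
From HB Require Import structures.
From mathcomp Require Import fintype finset zify.

(** The example lives on the Vamos matroid, which has rank 4 and eight elements
    grouped in four lines A, B, C, D: every two of these lines are coplanar
    except C and D. The bundle sends x >= 0 to x times the indicator of A and
    x <= 0 to -x times the indicator of B ([two_rays]). Each half line lands in
    an apartment because a basis can be chosen to contain a basis of a given
    flat.

    A point x * 1_F with x > 0 and F a flat lies in the apartment of a basis B0
    exactly when B0 contains a basis of F ([ray_apartment],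
    [apartment_ray_adapted]). If the bundle given by flats F and G is split, one
    basis B0 is therefore adapted to both, and counting the elements of B0 in F,
    G, their union and their intersection shows that F and G form a modular pair
    ([adapted_modular]).

    A matroid extension sends the bundle of F and G to the bundle of the spans
    of their images ([push_two_rays]). So a split extension of the example would
    be a matroid M', containing the Vamos matroid with the same ranks, in which
    the spans of A and B form a modular pair: these coplanar lines would meet in
    a point p. That is impossible. The planes AC and BC meet in the line C, so p
    lies on C, and likewise p lies on D; then C and D meet and are coplanar.
    Written with ranks, this argument says that a modular pair satisfies
    Ingleton's inequality with any two further sets ([ingleton_of_modular]).
    The inequality only involves ranks of sets of the small matroid, so it
    would hold there ([ingleton_of_modular_extension]), but the Vamos matroid
    violates it ([vamos_not_ingleton]). *)

Set Implicit Arguments.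
Unset Strict Implicit.
Unset Printing Implicit Defensive.
Import Order.TTheory GRing.Theory Num.Theory.

(** * Rank, span and circuits *)

Section MatroidTheory.
Variables (E : finType) (M : matroid E).
Implicit Types (A B C F G I J X Y : {set E}) (e : E).
Local Notation r := (rank_of M).
Local Notation span := (mspan M).

Lemma card_indep_le_rank I A : indep M I -> I \subset A -> #|I| <= r A.
Proof.
move=> iI sIA; rewrite /rank_of.
by apply: (@leq_bigmax_cond _ _ (fun I : {set E} => #|I|)); rewrite iI.
Qed.

Lemma rank_le_indep A n :
  (forall I, indep M I -> I \subset A -> #|I| <= n) -> r A <= n.
Proof. by move=> le_n; apply/bigmax_leqP => I /andP[]; apply: le_n. Qed.

Lemma rank_le_card A : r A <= #|A|.
Proof. by apply: rank_le_indep => I _ /subset_leq_card. Qed.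

Lemma rank_indep I : indep M I -> r I = #|I|.
Proof.
by move=> iI; apply/eqP; rewrite eqn_leq rank_le_card card_indep_le_rank.
Qed.

Lemma rankS A B : A \subset B -> r A <= r B.
Proof.
move=> sAB; apply: rank_le_indep => I iI sIA.
by apply: card_indep_le_rank iI (subset_trans sIA sAB).
Qed.

Lemma rank_basis_extend I A : indep M I -> I \subset A ->
  exists J, [/\ indep M J, I \subset J, J \subset A & #|J| = r A].
Proof.
move=> iI sIA.
have [|J maxJ sIJ] := @maxset_exists _ [pred J | indep M J && (J \subset A)] I.
  by rewrite /= iI.
have /andP[iJ sJA] := maxsetp maxJ.
exists J; split=> //; apply/eqP; rewrite eqn_leq card_indep_le_rank //=.
apply: rank_le_indep => K iK sKA; rewrite leqNgt; apply/negP => lt_JK.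
have [e /setDP[eK eJ] ieJ] := indep_exchange iJ iK lt_JK.
have /maxsetP[_ /(_ (e |: J)) /=] := maxJ.
rewrite ieJ subUset sub1set (subsetP sKA) //= sJA subsetUr => /(_ isT isT) eqJ.
by rewrite -eqJ setU11 in eJ.
Qed.

Lemma rank_submodular A B : r (A :|: B) + r (A :&: B) <= r A + r B.
Proof.
have [I [iI _ sI <-]] := rank_basis_extend (indep0 M) (sub0set (A :&: B)).
have sIU : I \subset A :|: B.
  by apply: subset_trans sI _; apply: subset_trans (subsetIl A B) (subsetUl A B).
have [J [iJ sIJ sJ <-]] := rank_basis_extend iI sIU.
have -> : #|J| = #|J :&: A :|: J :&: B| by rewrite -setIUr (setIidPl sJ).
apply: leq_trans (_ : #|J :&: A| + #|J :&: B| <= _); last first.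
  by apply: leq_add; apply: card_indep_le_rank (subsetIr _ _);
     apply: indepS iJ; apply: subsetIl.
rewrite -(cardsUI (J :&: A)) leq_add2l subset_leq_card //.
by rewrite setIACA setIid subsetI sIJ.
Qed.

Lemma sub_span A : A \subset span A.
Proof.
by apply/subsetP => e eA; rewrite inE (setUidPr _) ?sub1set.
Qed.

Lemma rank_span A : r (span A) = r A.
Proof.
apply/eqP; rewrite eqn_leq (rankS (sub_span A)) andbT.
have [I [iI _ sIA cI]] := rank_basis_extend (indep0 M) (sub0set A).
apply: rank_le_indep => J iJ sJ; rewrite leqNgt -cI; apply/negP => lt_IJ.
have [e /setDP[/(subsetP sJ) + eI] ieI] := indep_exchange iI iJ lt_IJ.
rewrite inE => /eqP reA.
have := card_indep_le_rank ieI (setUS [set e] sIA).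
by rewrite reA cardsU1 eI -cI ltnn.
Qed.

Lemma spanS A B : A \subset B -> span A \subset span B.
Proof.
move=> sAB; apply/subsetP => e; rewrite !inE => /eqP reA.
rewrite eqn_leq andbC rankS ?subsetUr //=.
have := rank_submodular (e |: A) B.
rewrite -setUA (setUidPr sAB) reA addnC leqNgt => le_r.
rewrite leqNgt; apply: contra le_r => lt_r; rewrite -addnS leq_add //.
by apply: rankS; rewrite subsetI subsetUr.
Qed.

Lemma span_id A : span (span A) = span A.
Proof.
apply/eqP; rewrite eqEsubset sub_span andbT; apply/subsetP => e.
rewrite !inE rank_span => /eqP re; rewrite eqn_leq andbC rankS ?subsetUr //=.
by rewrite -re rankS // setUS // sub_span.
Qed.

Lemma span_sub A B : A \subset span B -> span A \subset span B.
Proof. by move/spanS; rewrite span_id. Qed.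

Lemma rank_eq_span A B : span A = span B -> r A = r B.
Proof. by move=> eqs; rewrite -rank_span eqs rank_span. Qed.

Lemma rank_spanU A B : r (span A :|: B) = r (A :|: B).
Proof.
apply: rank_eq_span; apply/eqP; rewrite eqEsubset; apply/andP; split.
  rewrite span_sub // subUset spanS ?subsetUl //=.
  exact: subset_trans (subsetUr A B) (sub_span _).
by rewrite spanS ?setSU ?sub_span.
Qed.

Lemma rank_Uspan A B : r (A :|: span B) = r (A :|: B).
Proof. by rewrite setUC rank_spanU setUC. Qed.

Lemma spanT A : r A = r setT -> span A = setT.
Proof.
move=> rA; apply/eqP; rewrite -subTset; apply/subsetP => e _.
by rewrite inE eqn_leq rA rankS ?subsetT //= -rA rankS ?subsetUr.
Qed.

Lemma indep_span_notin I e : indep M I -> e \notin I ->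
  (e \in span I) = ~~ indep M (e |: I).
Proof.
move=> iI eI; rewrite inE (rank_indep iI).
apply/idP/idP => [/eqP reI | dep].
  by apply/negP => /rank_indep; rewrite reI cardsU1 eI; lia.
rewrite eqn_leq -{2}(rank_indep iI) rankS ?subsetUr // andbT.
apply: rank_le_indep => J iJ sJ; rewrite leqNgt; apply: contra dep => lt_IJ.
suff <- : J = e |: I by [].
by apply/eqP; rewrite eqEcard sJ cardsU1 eI.
Qed.

Lemma span0 : loop_free M -> span set0 = set0.
Proof.
move=> lf; apply/setP => e; rewrite indep_span_notin ?indep0 ?inE //.
by rewrite setU0 lf.
Qed.

Lemma circuit_span C e : circuit M C -> e \in C -> e \in span (C :\ e).
Proof.
move=> /minsetP[depC minC] eC; rewrite indep_span_notin ?setD1K //;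
  last by rewrite !inE eqxx.
apply/negPn/negP => dep.
by have := minC _ dep (subsetDl _ _) => /setP /(_ e); rewrite !inE eqxx eC.
Qed.

Lemma basis_indep B : basis M B -> indep M B.
Proof. by apply: maxsetp. Qed.

Lemma basis_max B e : basis M B -> e \notin B -> ~~ indep M (e |: B).
Proof.
move=> /maxsetP[_ maxB]; apply: contra => /maxB <-; last exact: subsetUr.
exact: setU11.
Qed.

Lemma basis_extend I : indep M I -> exists2 B, basis M B & I \subset B.
Proof. by move=> iI; have [B] := maxset_exists iI; exists B. Qed.

Lemma fundamental_circuit B C e : basis M B -> circuit M C ->
  C \subset e |: B -> e \in C.
Proof.
move=> bB /minsetp depC sC; apply: contraNT depC => eC.
apply: indepS (basis_indep bB); apply/subsetP => x xC.
have := subsetP sC x xC; rewrite !inE => /orP[/eqP xe|//].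
by rewrite -xe xC in eC.
Qed.

Lemma fundamental_circuit_exists B e : basis M B -> e \notin B ->
  exists2 C, circuit M C & C \subset e |: B.
Proof.
move=> bB eB; have := basis_max bB eB.
by case/(@minset_exists _ [pred A | ~~ indep M A]) => C; exists C.
Qed.

(** * Adapted bases, modular pairs and Ingleton's inequality *)

(** Submodularity gives the opposite inequality, so this is equality of the
    two sides. *)
Definition modular_pair F G : bool :=
  r F + r G <= r (F :|: G) + r (F :&: G).

(** For a basis B and a flat F: some part of B is a basis of F. *)
Definition adapted B F : bool := F \subset span (B :&: F).

Lemma adapted_extend F : exists2 B, basis M B & adapted B F.
Proof.
have [I [iI _ sIF cI]] := rank_basis_extend (indep0 M) (sub0set F).
have [B bB sIB] := basis_extend iI; exists B => //.
apply: subset_trans (spanS (_ : I \subset _)); last by rewrite subsetI sIB.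
apply/subsetP => e eF; rewrite inE eqn_leq andbC rankS ?subsetUr //=.
by rewrite (rank_indep iI) cI rankS // subUset sub1set eF.
Qed.

(** An adapted basis B turns ranks into cardinals: r F = #|B :&: F|, and
    cardinals are modular. *)
Lemma adapted_modular B F G : basis M B -> adapted B F -> adapted B G ->
  modular_pair F G.
Proof.
move=> /basis_indep iB aF aG.
have iBI X : indep M (B :&: X) by apply: indepS iB; apply: subsetIl.
have le_r X : adapted B X -> r X <= #|B :&: X|.
  by move=> /rankS; rewrite rank_span (rank_indep (iBI X)).
have le_c X : #|B :&: X| <= r X by apply: card_indep_le_rank; rewrite ?subsetIr.
apply: leq_trans (leq_add (le_r _ aF) (le_r _ aG)) _.
by rewrite -cardsUI -setIUr setIACA setIid leq_add.
Qed.

(** Ingleton's inequality: it holds for subspaces of a vector space, where any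
    two subspaces form a modular pair, but not for all matroids. *)
Definition ingleton_holds F G C D : bool :=
  r F + r G + r (F :|: G :|: C) + r (F :|: G :|: D) + r (C :|: D) <=
  r (F :|: G) + r (F :|: C) + r (F :|: D) + r (G :|: C) + r (G :|: D).

(** The set X = F :&: G plays the role of the intersection point of two
    coplanar lines. Submodularity for F :|: C and G :|: C bounds the rank of
    X :|: C, and similarly for D; submodularity for X :|: C and X :|: D then
    bounds the rank of C :|: D in terms of that of X, which modularity makes
    large. *)
Lemma ingleton_of_modular F G C D : modular_pair F G -> ingleton_holds F G C D.
Proof.
rewrite /modular_pair /ingleton_holds => mFG; set X := F :&: G in mFG.
have sub Y : r (F :|: G :|: Y) + r (X :|: Y) <= r (F :|: Y) + r (G :|: Y).
  by have := rank_submodular (F :|: Y) (G :|: Y); rewrite -setUUl -setUIl.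
have subX : r (C :|: D) + r X <= r (X :|: C) + r (X :|: D).
  apply: leq_trans (rank_submodular _ _); rewrite leq_add // rankS //.
    by rewrite -setUUr subsetUr.
  by rewrite -setUIr subsetUl.
have := sub C; have := sub D; lia.
Qed.
End MatroidTheory.

(** * Matroid extensions *)

Lemma rank_extension (E1 E2 : finType) (M1 : matroid E1) (M2 : matroid E2)
    (phi : E1 -> E2) (A : {set E1}) :
  matroid_extension M1 M2 phi -> rank_of M2 (phi @: A) = rank_of M1 A.
Proof.
move=> [inj_phi _ iphi]; apply/eqP; rewrite eqn_leq; apply/andP; split.
  apply: rank_le_indep => I iI sI.
  have eqI : I = phi @: (phi @^-1: I :&: A).
    apply/setP => y; apply/idP/imsetP => [yI | [x]].
      have /imsetP[x xA yx] := subsetP sI y yI.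
      by exists x => //; rewrite !inE -yx yI.
    by rewrite !inE => /andP[xI _] ->.
  rewrite eqI card_imset //; apply: card_indep_le_rank (subsetIr _ _).
  by rewrite -iphi -eqI.
apply: rank_le_indep => I iI sI; rewrite -(card_imset _ inj_phi).
by apply: card_indep_le_rank; rewrite ?iphi // imsetS.
Qed.

(** Ingleton's inequality in M1 only needs a modular pair in some extension:
    its terms do not change when C and D are replaced by their images, F and G
    by the spans of their images. *)
Lemma ingleton_of_modular_extension (E1 E2 : finType)
    (M1 : matroid E1) (M2 : matroid E2) (phi : E1 -> E2) (F G C D : {set E1}) :
  matroid_extension M1 M2 phi ->
  modular_pair M2 (mspan M2 (phi @: F)) (mspan M2 (phi @: G)) ->
  ingleton_holds M1 F G C D.
Proof.
move=> ext /(@ingleton_of_modular _ M2 _ _ (phi @: C) (phi @: D)).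
have rank_span2U A B Y :
    rank_of M2 (mspan M2 A :|: mspan M2 B :|: Y) = rank_of M2 (A :|: B :|: Y).
  by rewrite -setUA rank_spanU setUCA rank_spanU setUCA setUA.
rewrite /ingleton_holds !rank_span2U !(rank_spanU, rank_Uspan) !rank_span.
by rewrite -!imsetU !(rank_extension _ ext).
Qed.

(** * Bundles supported on one or two flats *)

Section Ray.
Local Open Scope ring_scope.
Variables (R : realType) (E : finType).
Implicit Types (F G : {set E}) (x : R).

(** The regular module structures on source and target let this be
    the linear map asked for in an apartment. *)
Definition ray F (x : R^o) : {ffun E -> R^o} :=
  [ffun e => if e \in F then x else 0].

Lemma ray_is_linear F : linear (ray F).
Proof.
move=> a x y; apply/ffunP => e; rewrite !ffunE.
by case: ifP; rewrite ?scaler0 ?addr0.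
Qed.

HB.instance Definition _ F :=
  GRing.isLinear.Build R R^o {ffun E -> R^o} _ (ray F) (ray_is_linear F).

(** The two formulas agree at 0, so each half line sees a single ray. *)
Definition two_rays F G x : {ffun E -> R} :=
  if 0 <= x then ray F x else ray G (- x).

Lemma two_rays_ge0 F G x : 0 <= x -> two_rays F G x = ray F x.
Proof. by rewrite /two_rays => ->. Qed.

Lemma two_rays_le0 F G x : x <= 0 -> two_rays F G x = ray G (- x).
Proof.
rewrite /two_rays; case: ltgtP => // -> _.
by rewrite oppr0 !(linear0 (ray _)).
Qed.

Variable M : matroid E.
Hypothesis lfM : loop_free M.

(** The minimum of x * 1_F over a circuit C is attained on the part of C outside
    F, if there is one. A single element there would be in the span of the rest
    of C, hence in F. *)
Lemma ray_berg F x : mspan M F \subset F -> 0 <= x -> berg M (ray F x).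
Proof.
move=> flatF x_ge0 C cC.
suff: (2 <= #|if C \subset F then C else C :\: F|)%N.
  move=> /leq_trans; apply; apply: subset_leq_card; apply/subsetP => i.
  rewrite inE; case: ifPn => [/subsetP sCF iC | _ /setDP[iC iF]];
    rewrite iC /=; apply/forallP => j; apply/implyP => jC; rewrite !ffunE.
    by rewrite !sCF.
  by rewrite (negPf iF); case: ifP.
have [depC minC] := minsetP cC.
case: ifPn => [_ | /subsetPn[e eC eF]].
  rewrite ltnNge; apply/negP => /card_le1_eqP C1.
  have [C0 | /set0Pn[e eC]] := eqVneq C finset.set0.
    by rewrite C0 indep0 in depC.
  suff eqC : C = [set e]%SET by rewrite eqC lfM in depC.
  by apply/setP => f; rewrite inE; apply/idP/eqP => [fC|->//]; apply: C1.
rewrite ltnNge; apply/negP => /card_le1_eqP C1.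
case/negP: (eF); apply: (subsetP flatF).
apply: subsetP (circuit_span cC eC); apply: spanS.
apply/subsetP => f /setD1P[fe fC]; apply: contraNT fe => fF.
by apply/eqP/C1; rewrite inE ?fC ?eC ?fF ?eF.
Qed.

(** Let C be the fundamental circuit of e. When e is outside the flat F, the
    rest of C cannot lie in F, so its minimum is 0. When e is in F, it is
    already spanned by B :&: F, and then all of C lies in F: an element b of C
    outside F would be spanned by C :\ b, hence by B :\ b since this set
    spans e. *)
Lemma ray_apartment B F x : basis M B -> mspan M F \subset F -> adapted M B F ->
  0 <= x -> apartment M B (ray F x).
Proof.
move=> bB flatF aF x_ge0; split; first exact: ray_berg.
move=> e C eB cC sC; have eC := fundamental_circuit bB cC sC.
have sCB : C :\ e \subset B by rewrite subDset.
have [eF | eF] := boolP (e \in F).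
  have sCF b : b \in C :\ e -> b \in F.
    move=> bCe; have [be bC] := setD1P bCe.
    have bB' := subsetP sCB b bCe; apply: contraLR bB' => bF.
    have sBF : B :&: F \subset B :\ b.
      apply/subsetP => f /setIP[fB fF]; rewrite !inE fB andbT.
      by apply: contraNneq bF => <-.
    have eS : e \in mspan M (B :\ b).
      by apply: (subsetP (spanS M sBF)); apply: (subsetP aF).
    have iBb : indep M (B :\ b) by apply: indepS (basis_indep bB); apply: subsetDl.
    have /subsetP/(_ b (circuit_span cC bC)) :
        mspan M (C :\ b) \subset mspan M (B :\ b).
      apply: span_sub; apply/subsetP => f /setD1P[fb fC].
      have [->//|fe] := eqVneq f e.
      by apply: (subsetP (sub_span _ _)); rewrite !inE fb (subsetP sCB) // !inE fe.
    rewrite indep_span_notin ?inE ?eqxx //.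
    apply: contra => bB'; rewrite setD1K //; exact: basis_indep.
  split=> [|b /sCF bF]; last by rewrite !ffunE eF bF.
  have [b bCe] : exists b, b \in C :\ e.
    apply/set0Pn; apply/eqP => C0; have := circuit_span cC eC.
    by rewrite C0 span0 // inE.
  by exists b => //; rewrite !ffunE eF (sCF b).
split=> [|b _]; last by rewrite !ffunE (negPf eF); case: ifP.
have /subsetPn[b bC bF] : ~~ (C :\ e \subset F).
  apply: contra eF => sCF; apply: (subsetP flatF); apply: (subsetP (spanS M sCF)).
  exact: circuit_span.
by exists b; rewrite // !ffunE (negPf eF) (negPf bF).
Qed.

(** The value x > 0 at e in F is the minimum over the rest of the fundamental
    circuit of e, which thus lies in B :&: F and spans e. *)
Lemma apartment_ray_adapted B F x : basis M B -> 0 < x ->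
  apartment M B (ray F x) -> adapted M B F.
Proof.
move=> bB x_gt0 [_ minB]; apply/subsetP => e eF.
have [eB | eB] := boolP (e \in B).
  by apply: (subsetP (sub_span _ _)); rewrite inE eB.
have [C cC sC] := fundamental_circuit_exists bB eB.
have eC := fundamental_circuit bB cC sC.
have [_ minC] := minB e C eB cC sC.
apply: (subsetP (spanS M _)) (circuit_span cC eC).
apply/subsetP => b bC; rewrite inE; apply/andP; split.
  by apply: subsetP bC; rewrite subDset.
have := minC b bC; rewrite !ffunE eF; case: ifP => // _.
by rewrite leNgt x_gt0.
Qed.

Lemma two_rays_bundle F G : mspan M F \subset F -> mspan M G \subset G ->
  toric_bundle_P1 M (two_rays F G).
Proof.
move=> flatF flatG; split.
- move=> x; rewrite /two_rays; case: ifPn => x0; apply: ray_berg => //.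
  by rewrite oppr_ge0 ltW // ltNge.
- move=> n e; rewrite /two_rays.
  by case: ifP => _; rewrite ffunE; case: ifP; rewrite ?rpredN ?rpred0 ?intr_int.
- have [B bB aB] := adapted_extend M F; exists B; split=> //.
    move=> x; rewrite in_itv /= andbT => x0.
    by rewrite two_rays_ge0 //; apply: ray_apartment.
  exists (ray F) => x; rewrite in_itv /= andbT => x0 b _.
  by rewrite two_rays_ge0.
- have [B bB aB] := adapted_extend M G; exists B; split=> //.
    move=> x; rewrite in_itv /= => x0.
    by rewrite two_rays_le0 //; apply: ray_apartment; rewrite ?oppr_ge0.
  exists (\- (ray G))%R => x; rewrite in_itv /= => x0 b _.
  by rewrite two_rays_le0 // linearN.
Qed.

(** The values of the bundle at 1 and -1 already detect F and G. *)
Lemma split_two_rays_modular F G : split_bundle M (two_rays F G) ->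
  modular_pair M F G.
Proof.
move=> [B bB aB]; apply: (adapted_modular bB).
  by apply: (apartment_ray_adapted bB ltr01); rewrite -(two_rays_ge0 F G) ?aB.
apply: (apartment_ray_adapted bB ltr01).
by have := aB (-1); rewrite two_rays_le0 ?opprK // oppr_le0.
Qed.
End Ray.

(** * Pushing rays forward along an extension *)

Section Push.
Local Open Scope ring_scope.
Variables (R : realType) (E1 E2 : finType) (M1 : matroid E1) (M2 : matroid E2).
Variable phi : E1 -> E2.
Hypotheses (lfM2 : loop_free M2) (ext : matroid_extension M1 M2 phi).

Lemma sup_itvNyc (x : R) : sup [set t | t <= x]%classic = x.
Proof. by rewrite -[RHS](@sup_itv R -oo%O false x). Qed.

(** The level sets of x * 1_F are everything, F and the empty set. Their spans
    in M2 are everything because the ranks of M1 and M2 agree, the span of F,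
    and the empty set because M2 has no loops. *)
Lemma push_ray (F : {set E1}) (x : R) : 0 <= x ->
  berg_push M2 phi (ray F x) = ray (mspan M2 (phi @: F)) x.
Proof.
move=> x_ge0; apply/ffunP => e; rewrite !ffunE.
have level_le t : t <= x -> F \subset level_set (ray F x) t.
  by move=> tx; apply/subsetP => i iF; rewrite inE ffunE iF.
have level_gt0 t : 0 < t -> level_set (ray F x) t \subset F.
  move=> t_gt0; apply/subsetP => i; rewrite inE ffunE; case: ifP => // _.
  by rewrite leNgt t_gt0.
have level_gt t : x < t -> level_set (ray F x) t = finset.set0.
  move=> tx; apply/setP => i; rewrite !inE ffunE; apply/negbTE.
  by case: ifP => _; rewrite -ltNge // (le_lt_trans x_ge0).
have level_le0 t : t <= 0 -> level_set (ray F x) t = [set: E1]%SET.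
  move=> t0; apply/setP => i; rewrite !inE ffunE.
  by case: ifP => // _; apply: le_trans x_ge0.
case: ifPn => eF.
  rewrite -[RHS]sup_itvNyc; congr sup; apply/seteqP; split=> t /=; last first.
    by move=> tx; apply: subsetP eF; apply/spanS/imsetS/level_le.
  by case: leP => // /level_gt ->; rewrite imset0 span0 // inE.
rewrite -[RHS]sup_itvNyc; congr sup; apply/seteqP; split=> t /=; last first.
  move=> /level_le0 ->; rewrite spanT ?inE // (rank_extension _ ext).
  by have [_ + _] := ext.
case: leP => // /level_gt0 sF eS; case/negP: eF; apply: subsetP eS.
exact/spanS/imsetS.
Qed.

Lemma push_two_rays (F G : {set E1}) :
  (fun x : R => berg_push M2 phi (two_rays F G x)) =
  two_rays (mspan M2 (phi @: F)) (mspan M2 (phi @: G)).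
Proof.
apply/funext => x; rewrite /two_rays; case: ifPn => x0; rewrite push_ray //.
by rewrite oppr_ge0 ltW // ltNge.
Qed.
End Push.

(** * The Vamos matroid *)

Local Notation V := ((bool * bool) * bool)%type.

Section Vamos.
Implicit Types (I J S : {set V}) (u v : bool * bool) (x e f : V).

(** The lines A, B, C, D are those of (false, false), (false, true),
    (true, false), (true, true). *)
Definition line u : {set V} := [set x | x.1 == u].

Definition partner x : V := (x.1, ~~ x.2).

Definition saturated S : bool := [forall x, (partner x \in S) == (x \in S)].

Definition twisted_pair : {set V} := line (true, false) :|: line (true, true).

(** The saturated sets of size 4 are the unions of two lines; this description
    makes the exchange property a statement about the involution [partner]. *)
Definition vamos_plane S : bool :=
  [&& #|S| == 4, saturated S & S != twisted_pair].

Definition vamos_indep S : bool := (#|S| <= 4) && ~~ vamos_plane S.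

Lemma saturatedP S :
  reflect (forall x, (partner x \in S) = (x \in S)) (saturated S).
Proof. exact: 'forall_eqP. Qed.

Lemma saturated_lines u v : saturated (line u :|: line v).
Proof. by apply/saturatedP => x; rewrite !inE. Qed.

Lemma card_lines u v : u != v -> #|line u :|: line v| = 4.
Proof.
move=> uv; have -> : line u :|: line v = setX [set u; v] setT.
  by apply/setP => -[x b]; rewrite !inE andbT.
by rewrite cardsX cards2 uv cardsT card_bool.
Qed.

Lemma card_line u : #|line u| = 2.
Proof.
have -> : line u = setX [set u] setT.
  by apply/setP => -[x b]; rewrite !inE andbT.
by rewrite cardsX cards1 cardsT card_bool.
Qed.

Lemma vamos_indep_small S : #|S| <= 3 -> vamos_indep S.
Proof. by move=> S3; rewrite /vamos_indep /vamos_plane; case: eqP; lia. Qed.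

Lemma vamos_indep0 : vamos_indep finset.set0.
Proof. by rewrite vamos_indep_small ?cards0. Qed.

Lemma vamos_indepS I J : I \subset J -> vamos_indep J -> vamos_indep I.
Proof.
move=> sIJ iJ; have [->//|neIJ] := eqVneq I J.
have ltIJ : #|I| < #|J| by rewrite proper_card // properEneq neIJ.
by case/andP: iJ => J4 _; apply: vamos_indep_small; lia.
Qed.

(** If e and f were distinct, the partner of e would be in f |: I, hence so
    would e. *)
Lemma saturated_extension_unique I e f : e \notin I -> f \notin I ->
  saturated (e |: I) -> saturated (f |: I) -> e = f.
Proof.
move=> eI fI /saturatedP satE /saturatedP satF; apply/eqP/negPn/negP => ef.
have eIF : partner e \in f |: I.
  have := satE e; rewrite setU11 !inE => /orP[/eqP | ->]; last by rewrite orbT.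
  (* The partner of e differs from e. *)
  by case: e {eI satE ef} => [a []].
have := satF e; rewrite eIF !inE (negPf eI) orbF => /esym/eqP eqef.
by rewrite eqef eqxx in ef.
Qed.

(** Exchange can only fail when each e in J :\: I completes I to a plane. By
    [saturated_extension_unique] only one e can do this, so J would be the
    plane e |: I, but J is independent. *)
Lemma vamos_indep_exchange I J :
  vamos_indep I -> vamos_indep J -> #|I| < #|J| ->
  exists2 e, e \in J :\: I & vamos_indep (e |: I).
Proof.
move=> iI iJ ltIJ; have [J4 _] := andP iJ.
have [e eJI] : exists e, e \in J :\: I.
  apply/set0Pn; rewrite setD_eq0; apply: contraL ltIJ => /subset_leq_card.
  by rewrite -leqNgt.
have [eI eJ] := setDP eJI.
have [ieI|dep] := boolP (vamos_indep (e |: I)); first by exists e.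
have cI f : f \notin I -> #|f |: I| = #|I|.+1 by move=> fI; rewrite cardsU1 fI.
have pl f : f \notin I -> ~~ vamos_indep (f |: I) -> saturated (f |: I).
  move=> fI; rewrite /vamos_indep cI // (leq_trans ltIJ J4) negbK.
  by case/and3P.
have [f fJI neef] : exists2 f, f \in J :\: I & f != e.
  apply/exists_inP; apply: contraT => /exists_inPn all_e.
  suff eqJ : J = e |: I by rewrite -eqJ iJ in dep.
  apply/eqP; rewrite eqEcard cI // ltIJ andbT; apply/subsetP => f fJ.
  rewrite !inE; have [//|fI] := boolP (f \in I); first by rewrite orbT.
  by have := all_e f; rewrite inE fI fJ negbK => /(_ isT) ->.
have [fJ fI] := setDP fJI.
exists f => //; apply: contraNT neef => dep_f.
by apply/eqP; apply: saturated_extension_unique (pl _ fI dep_f) (pl _ _ dep).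
Qed.

Definition vamos : matroid V :=
  Matroid vamos_indep0 vamos_indepS vamos_indep_exchange.

Lemma vamos_loop_free : loop_free vamos.
Proof. by move=> e; apply: vamos_indep_small; rewrite cards1. Qed.

Local Notation r := (rank_of vamos).

Lemma rank_line u : r (line u) = 2.
Proof.
by rewrite rank_indep ?card_line //; apply: vamos_indep_small; rewrite card_line.
Qed.

Lemma line_flat u : mspan vamos (line u) = line u.
Proof.
apply/eqP; rewrite eqEsubset sub_span andbT; apply/subsetP => e.
apply: contraTT => eu; rewrite indep_span_notin // ?negbK;
  apply: vamos_indep_small; by rewrite ?cardsU1 ?eu card_line.
Qed.

Lemma rank_coplanar u v : u != v -> line u :|: line v != twisted_pair ->
  r (line u :|: line v) <= 3.
Proof.
move=> uv nt; apply: rank_le_indep => I /andP[I4 npl] sI.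
rewrite leqNgt; apply: contra npl => I4'.
have -> : I = line u :|: line v by apply/eqP; rewrite eqEcard sI card_lines.
by rewrite /vamos_plane card_lines // saturated_lines nt.
Qed.

Lemma rank_twisted_pair : r twisted_pair = 4.
Proof.
rewrite rank_indep ?card_lines //=.
by rewrite /vamos_indep /vamos_plane eqxx !andbF card_lines.
Qed.

(** One line together with one point on each of the two others is independent:
    it contains (v, true) but not its partner. *)
Lemma rank_three_lines u v w : u != v -> u != w -> v != w ->
  4 <= r (line u :|: line v :|: line w).
Proof.
move=> uv uw vw.
pose S : {set V} := (w, true) |: ((v, true) |: line u).
have vS : (v, false) \notin S.
  by rewrite /S !inE !xpair_eqE !andbF /= eq_sym.
have cS : #|S| = 4.
  rewrite !cardsU1 card_line !inE !xpair_eqE /= andbT.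
  by rewrite (eq_sym w v) (negPf vw) (eq_sym w u) (negPf uw) eq_sym uv.
rewrite -cS; apply: card_indep_le_rank.
  rewrite /= /vamos_indep cS /= /vamos_plane.
  apply/negP => /and3P[_ /saturatedP/(_ (v, true))].
  by rewrite (negPf vS) !inE eqxx orbT.
by rewrite !subUset !sub1set !inE /= !eqxx !orbT -setUA subsetUl.
Qed.

(** The left-hand side is 2 + 2 + 4 + 4 + 4 and the right-hand side at most
    3 + 3 + 3 + 3 + 3. *)
Lemma vamos_not_ingleton :
  ~~ ingleton_holds vamos (line (false, false)) (line (false, true))
                          (line (true, false)) (line (true, true)).
Proof.
rewrite /ingleton_holds -/twisted_pair rank_twisted_pair !rank_line -ltnNge.
have coplanar u v : ~~ (u.1 && v.1) -> u != v -> r (line u :|: line v) <= 3.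
  move=> uv1 uv; apply: rank_coplanar => //; apply: contra uv1 => /eqP/setP eqT.
  have := eqT (u, true); have := eqT (v, true); rewrite !inE !eqxx orbT /=.
  by case: u v {uv eqT} => [[] u2] [[] v2].
have := coplanar (false, false) (false, true) isT isT.
have := coplanar (false, false) (true, false) isT isT.
have := coplanar (false, false) (true, true) isT isT.
have := coplanar (false, true) (true, false) isT isT.
have := coplanar (false, true) (true, true) isT isT.
have := @rank_three_lines (false, false) (false, true) (true, false) isT isT isT.
have := @rank_three_lines (false, false) (false, true) (true, true) isT isT isT.
lia.
Qed.
End Vamos.

(** * The example *)

Theorem theorem1p17 (R : realType) :
  exists (E : finType) (M : matroid E) (Phi : R -> {ffun E -> R}),
    [/\ loop_free M,
        toric_bundle_P1 M Phi &
        forall (E' : finType) (M' : matroid E') (phi : E -> E'),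
          loop_free M' ->
          matroid_extension M M' phi ->
          toric_bundle_P1 M' (fun x => berg_push M' phi (Phi x)) /\
          ~ split_bundle M' (fun x => berg_push M' phi (Phi x))].
Proof.
exists V, vamos, (two_rays (line (false, false)) (line (false, true))).
split; [exact: vamos_loop_free | | move=> E' M' phi lf' ext].
  by apply: two_rays_bundle; rewrite ?line_flat //; exact: vamos_loop_free.
rewrite (push_two_rays R lf' ext); split.
  by apply: two_rays_bundle; rewrite ?span_id.
move=> /split_two_rays_modular modular; apply: (negP vamos_not_ingleton).
exact: ingleton_of_modular_extension ext modular.
Qed.
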